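(* For every positive even integer $n$, there exist a monotone Boolean network $f:\{0,1\}^n\to\{0,1\}^n$ and two configurations $x,y\in\{0,1\}^n$ such that $y$ is a fixed point of $f$ and \[ \mathrm{diam}(\Gamma(f))\geq d_{\Gamma(f)}(x,y)\geq 2^{\frac{n}{2}}. \]
   Context: A Boolean network is a map $f:\{0,1\}^n\to\{0,1\}^n$, $x\mapsto (f_1(x),\dots,f_n(x))$. It is monotone if $x\leq y$ implies $f(x)\leq f(y)$, where $\leq$ is the componentwise order on $\{0,1\}^n$. The asynchronous graph $\Gamma(f)$ is the directed graph with vertex set $\{0,1\}^n$ and an arc (transition) from $x$ to $y$ whenever there is $i\in[n]$ with $f_i(x)=y_i\neq x_i$ and $y_j=x_j$ for all $j\neq i$. $d_{\Gamma(f)}(x,y)$ is the minimal number of arcs in a directed path of $\Gamma(f)$ from $x$ to $y$ ($\infty$ if none exists), and $\mathrm{diam}(\Gamma(f))=\max\{d_{\Gamma(f)}(x,y): x,y\in\{0,1\}^n,\ d_{\Gamma(f)}(x,y)<\infty\}$. *)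

(* Defs.v *)
From mathcomp Require Import all_boot.

Set Implicit Arguments.
Unset Strict Implicit.
Unset Printing Implicit Defensive.

Section Distance.

Variables (T : finType) (e : rel T).

(* There is a directed path from x to y with exactly k arcs; vertices may be
   repeated, which does not affect the minimal length. *)
Definition walk (x y : T) (k : nat) : bool :=
  [exists p : k.-tuple T, path e x p && (last x p == y)].

Lemma connect_walk (x y : T) : connect e x y -> exists k, walk x y k.
Proof.
case/connectP=> p e_p ->; exists (size p).
by apply/existsP; exists (in_tuple p); rewrite e_p eqxx.
Qed.

(* Distances live in nat extended with infinity: None stands for infinity. *)
Definition dist (x y : T) : option nat :=
  match @idP (connect e x y) with
  | ReflectT xy => Some (ex_minn (connect_walk xy))
  | ReflectF _ => None
  end.

(* Maximum of the finite distances; odflt only strips the Some. *)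
Definition diam : nat :=
  \max_(x : T) \max_(y : T | dist x y != None) odflt 0 (dist x y).

End Distance.

Definition enat_le (a b : option nat) : bool :=
  match a, b with
  | _, None => true
  | None, Some _ => false
  | Some k, Some l => k <= l
  end.

Definition config (n : nat) : finType := {ffun 'I_n -> bool}.

(* Booleans are coerced to 0 and 1 in nat. *)
Definition config_le (n : nat) (x y : config n) : bool :=
  [forall i, x i <= y i].

Definition monotone_network (n : nat) (f : config n -> config n) : Prop :=
  forall x y : config n, config_le x y -> config_le (f x) (f y).

Definition async (n : nat) (f : config n -> config n) : rel (config n) :=
  fun x y => [exists i : 'I_n,
    [&& f x i == y i, y i != x i & [forall (j | j != i), y j == x j]]].

(* Main.v *)
(** Write [n = 2m].  Encoding [w] in [{0,1}^m] by the pairs (w_q, ~~ w_q), a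
    Gray code becomes a sequence [c 0, ..., c N] in [{0,1}^n], with
    [N = 2^m - 1], in which each term is obtained from the previous one by
    moving a single 1, and such that [c j <= u k := c k \/ c k.+1] only for
    [j = k] and [j = k.+1].  Let [f z] be the all-ones configuration if [z] lies
    below no [u k], and otherwise the join of the [c j.+1] with [c j <= z].
    Asynchronously, [c k] can only move to [u k] or to a configuration above no
    [c j], from which one can only decrease; and [u k] can only move to [c k.+1]
    or to a configuration below no [u l], from which one can only increase.
    Hence every path from [c 0] to [c N] visits
    [c 0, u 0, c 1, u 1, ..., c N], and has length [2N >= 2^m]. *)
Require Import Defs.
From mathcomp Require Import all_boot.

Set Implicit Arguments.
Unset Strict Implicit.
Unset Printing Implicit Defensive.

(** * Distances, the componentwise order and transitions *)

Lemma dist_le_diam (T : finType) (e : rel T) (x y : T) :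
  connect e x y -> enat_le (dist e x y) (Some (diam e)).
Proof.
move=> xy; have dxy : dist e x y != None by rewrite /dist; case: {-}_ / idP.
case E: (dist e x y) dxy => [d|//] _ /=.
have -> : d = odflt 0 (dist e x y) by rewrite E.
apply: leq_trans (leq_bigmax x).
by apply: (leq_bigmax_cond (F := fun z => odflt 0 (dist e x z))); rewrite E.
Qed.

Lemma le_dist (T : finType) (e : rel T) (x y : T) (d : nat) :
  (forall p, path e x p -> last x p = y -> d <= size p) ->
  enat_le (Some d) (dist e x y).
Proof.
move=> dP; rewrite /dist; case: {-}_ / idP => [xy|//] /=.
case: ex_minnP => k /existsP[p /andP[e_p /eqP p_y]] _.
by rewrite -(size_tuple p) dP.
Qed.

Lemma config_leP n (x y : config n) :
  reflect (forall i, x i -> y i) (config_le x y).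
Proof.
apply: (iffP forallP) => xy i; first by move=> xi; move: (xy i); rewrite xi; case: (y i).
by move: (xy i); case: (x i) => // ->.
Qed.

Lemma config_lexx n (x : config n) : config_le x x.
Proof. exact/config_leP. Qed.

Lemma config_le_trans n (y x z : config n) :
  config_le x y -> config_le y z -> config_le x z.
Proof.
by move=> /config_leP xy /config_leP yz; apply/config_leP=> i /xy /yz.
Qed.

Lemma asyncP n (f : config n -> config n) (x y : config n) :
  reflect (exists i, [/\ f x i = ~~ x i, y i = ~~ x i & forall j, j != i -> y j = x j])
          (async f x y).
Proof.
apply: (iffP existsP) => -[i].
  case/and3P=> /eqP fy yx /forallP eq_yx; exists i.
  have yi : y i = ~~ x i by case: (y i) (x i) yx => [] [].
  split; rewrite ?fy // => j ji; apply/eqP.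
  by move: (eq_yx j); rewrite ji.
case=> fx yi eq_yx; exists i; rewrite fx yi eqxx /=.
apply/andP; split; first by case: (x i).
by apply/forallP=> j; apply/implyP=> /eq_yx ->.
Qed.

(** * The network climbing along an abstract sequence [c] *)

Section Climb.

Variables (n N : nat) (c : nat -> config n).

Definition link (k : nat) : config n := [ffun i => c k i || c k.+1 i].

(** The index [j] may equal [N], so [c N.+1] enters the join; under [c_end] it is [c N], which makes
    [c N] a fixed point. *)
Definition climb (z : config n) : config n :=
  [ffun i => [exists j : 'I_N.+1, config_le (c j) z && c j.+1 i]
          || ~~ [exists k : 'I_N, config_le z (link k)]].

Lemma climb_monotone : monotone_network climb.
Proof.
move=> x y xy; apply/config_leP=> i; rewrite !ffunE.
case/orP=> [/existsP[j /andP[jx ji]]|/existsP nx].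
  by apply/orP; left; apply/existsP; exists j; rewrite (config_le_trans jx xy).
apply/orP; right; apply/existsP=> -[k yk]; apply: nx.
by exists k; apply: config_le_trans yk.
Qed.

Hypothesis N_gt0 : 0 < N.

Hypothesis c_step : forall k, k < N -> exists a r,
  [/\ c k a = false, c k.+1 a, c k r, c k.+1 r = false &
      forall i, i != a -> i != r -> c k.+1 i = c k i].

Hypothesis c_link : forall j k, j <= N -> k < N ->
  config_le (c j) (link k) -> j = k \/ j = k.+1.

Hypothesis c_end : c N.+1 = c N.

Lemma le_linkl k : config_le (c k) (link k).
Proof. by apply/config_leP=> i ci; rewrite ffunE ci. Qed.

Lemma le_linkr k : config_le (c k.+1) (link k).
Proof. by apply/config_leP=> i ci; rewrite ffunE ci orbT. Qed.

(** As [c k] lies below [link k], or below [link N.-1] when [k = N], [c_link] leaves a single wrong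
    index; a coordinate moved between the two neighbours excludes it. *)
Lemma c_antichain j k : j <= N -> k <= N -> config_le (c j) (c k) -> j = k.
Proof.
move=> jN; rewrite leq_eqVlt => /orP[/eqP->|kN] jk.
  have pN : N.-1 < N by rewrite prednK.
  have := le_linkr N.-1; rewrite prednK // => /(config_le_trans jk) /(c_link jN pN).
  rewrite prednK // => -[jE|//].
  have [a [r [_ _ cr]]] := c_step pN.
  rewrite prednK // => cr' _; move/config_leP: jk => /(_ r).
  by rewrite jE cr cr' => /(_ isT).
have [//|jE] := c_link jN kN (config_le_trans jk (le_linkl k)).
have [a [r [ca ca' _ _ _]]] := c_step kN.
by move/config_leP: jk => /(_ a); rewrite jE ca ca' => /(_ isT).
Qed.

(** By [c_link], no terms other than [c k] and [c k.+1] can lie below [z]. *)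
Lemma climbE z k i : k < N -> config_le z (link k) ->
  climb z i = config_le (c k) z && c k.+1 i || config_le (c k.+1) z && c k.+2 i.
Proof.
move=> kN zk; rewrite ffunE; have -> : [exists k : 'I_N, config_le z (link k)].
  by apply/existsP; exists (Ordinal kN).
rewrite orbF; apply/existsP/orP=> [[j /andP[jz ji]]|[]] /=.
- have jN : j <= N by rewrite -ltnS.
  by case: (c_link jN kN (config_le_trans jz zk)) => <-; rewrite jz ji; [left|right].
- by move=> kz; exists (Ordinal (leqW kN)).
- by move=> kz; exists (Ordinal (kN : k.+1 < N.+1)).
Qed.

Lemma climb_link k i : k < N -> climb (link k) i = c k.+1 i || c k.+2 i.
Proof. by move=> kN; rewrite (climbE _ kN) ?config_lexx ?le_linkl ?le_linkr. Qed.

Lemma climb_c k : k <= N -> climb (c k) = c k.+1.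
Proof.
rewrite leq_eqVlt => /orP[/eqP->|kN]; apply/ffunP=> i.
  have pN : N.-1 < N by rewrite prednK.
  rewrite (climbE (k := N.-1)) ?prednK //; last first.
    by have := le_linkr N.-1; rewrite prednK.
  rewrite config_lexx /=; case E: (config_le _ _) => //=.
  have := c_antichain (ltnW pN) (leqnn N) E.
  by move=> NE; rewrite NE ltnn in pN.
rewrite (climbE _ kN) ?le_linkl // config_lexx /=.
case E: (config_le _ _) => /=; last by rewrite orbF.
by have /n_Sn := esym (c_antichain kN (ltnW kN) E).
Qed.

(** If the 1 removed at step [k] came back at the next step, [c k.+2] would lie below [link k],
    against [c_link]. This is what lets [link k] drop that 1 and reach [c k.+1]. *)
Lemma link_removed k i : k < N -> c k i -> ~~ c k.+1 i -> ~~ c k.+2 i.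
Proof.
move=> kN ki k1i; apply/negP=> k2i.
have := kN; rewrite leq_eqVlt => /orP[/eqP kE|k1N].
  by move: k2i; rewrite kE c_end -kE (negPf k1i).
have [a [r [ca ca' cr cr' c_eq]]] := c_step k1N.
have ia : i = a.
  apply/eqP/negPn/negP=> ia; case: (eqVneq i r) => [ir|ir].
    by move: k1i; rewrite ir cr.
  by move: k2i; rewrite c_eq // (negPf k1i).
case: (@c_link k.+2 k) => //; last by move/eqP; rewrite eqSS gtn_eqF.
  apply/config_leP=> j; rewrite ffunE; case: (eqVneq j i) => [-> _|ji].
    by rewrite ki.
  case: (eqVneq j r) => [->|jr]; first by rewrite cr'.
  by rewrite c_eq -?ia // => ->; rewrite orbT.
by move/eqP; rewrite gtn_eqF.
Qed.

Lemma connect_climb k : k <= N -> connect (async climb) (c 0) (c k).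
Proof.
elim: k => [//|k IHk] kN; have [a [r [ca ca' cr cr' c_eq]]] := c_step kN.
apply: connect_trans (IHk (ltnW kN)) _.
apply: (@connect_trans _ _ (link k)); apply/connect1/asyncP.
  exists a; split; rewrite ?climb_c ?(ltnW kN) ?ffunE ?ca ?ca' // => j ja.
  rewrite ffunE; case: (eqVneq j r) => [->|jr]; first by rewrite cr.
  by rewrite c_eq ?orbb.
exists r; split; rewrite ?climb_link ?ffunE ?cr ?cr' //=.
  by apply/negbTE/(link_removed kN); rewrite ?cr'.
move=> j jr; rewrite ffunE; case: (eqVneq j a) => [->|ja]; first by rewrite ca' orbT.
by rewrite c_eq ?orbb.
Qed.

(** Invariant after [t] arcs from [c 0]. The first two cases follow the climb and bound its speed;
    the last two are traps, closed under transitions and avoiding [c N]. *)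
Inductive climb_inv (t : nat) (z : config n) : Prop :=
| ClimbCode k of k <= N & k.*2 <= t & z = c k
| ClimbLink k of k < N & k.*2 < t & z = link k
| ClimbLow k of k < N & config_le z (link k) &
    forall j, j <= N -> ~~ config_le (c j) z
| ClimbHigh of forall k, k < N -> ~~ config_le z (link k).

Lemma climb_inv_step t x y :
  async climb x y -> climb_inv t x -> climb_inv t.+1 y.
Proof.
case/asyncP=> i [fxi yi y_eq] [k kN kt xE|k kN kt xE|k kN xk xj|xh].
- move: fxi yi y_eq; rewrite {x}xE climb_c // => fxi yi y_eq.
  move: kN; rewrite leq_eqVlt => /orP[/eqP kE|kN].
    by move: fxi; rewrite kE c_end; case: (c N i).
  have [a [r [ca ca' cr cr' c_eq]]] := c_step kN.
  (* If [i] rises, it is the added coordinate [a] and [y] is [link k]; if it falls, [y] is strictly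
     below [c k], hence above no [c j]. *)
  case: (boolP (c k i)) => ki; last first.
    apply: (@ClimbLink _ _ k) => //; apply/ffunP=> j; rewrite ffunE.
    case: (eqVneq j i) => [->|ji]; first by rewrite yi fxi (negPf ki).
    rewrite y_eq //; case: (eqVneq j r) => [->|jr]; first by rewrite cr.
    case: (eqVneq j a) => [ja|ja]; last by rewrite c_eq // orbb.
    case: (eqVneq i a) => [ia|ia]; first by rewrite ja ia eqxx in ji.
    case: (eqVneq i r) => [ir|ir]; first by rewrite ir cr in ki.
    by move: fxi; rewrite c_eq //; case: (c k i).
  have yck : config_le y (c k).
    apply/config_leP=> j; case: (eqVneq j i) => [->//|ji].
    by rewrite y_eq.
  apply: (@ClimbLow _ _ k) => // [|j jN].
    exact: config_le_trans (le_linkl k).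
  apply/negP=> jy; have jE := c_antichain jN (ltnW kN) (config_le_trans jy yck).
  by move/config_leP: jy => /(_ i); rewrite jE ki yi ki => /(_ isT).
- move: fxi yi y_eq; rewrite {x}xE climb_link // => fxi yi y_eq.
  (* If [i] falls, it is the removed coordinate [r] and [y] is [c k.+1]. *)
  case ui: (link k i) fxi yi => /= fxi yi.
    apply: (@ClimbCode _ _ k.+1) => //; apply/ffunP=> j.
    have [k1i k2i] := norP (negbT fxi).
    have ki : c k i by move: ui; rewrite ffunE (negPf k1i) orbF.
    have [a [r [ca ca' cr cr' c_eq]]] := c_step kN.
    have ir : i = r.
      apply/eqP/negPn/negP=> ir; case: (eqVneq i a) => [ia|ia].
        by move: ki; rewrite ia ca.
      by move: k1i; rewrite c_eq // ki.
    case: (eqVneq j i) => [->|ji]; first by rewrite yi (negPf k1i).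
    rewrite y_eq // ffunE; case: (eqVneq j a) => [->|ja]; first by rewrite ca' orbT.
    by rewrite c_eq -?ir // orbb.
  (* Now [i] rises. A [link l] above [y] would be above both [c k] and [c k.+1], forcing [l = k],
     yet [y] is strictly above [link k]. *)
  apply: ClimbHigh => l lN; apply/negP=> yl.
  have k2i : c k.+2 i.
    by move: ui fxi; rewrite ffunE => /norP[_ /negPf->].
  have uy : config_le (link k) y.
    apply/config_leP=> j; case: (eqVneq j i) => [->|ji]; first by rewrite ui.
    by rewrite y_eq.
  have ul := config_le_trans uy yl.
  have kE : k = l.
    case: (c_link kN lN (config_le_trans (le_linkr k) ul)) => [lE|[]//].
    case: (c_link (ltnW kN) lN (config_le_trans (le_linkl k) ul)) => // /eqP.
    by rewrite -lE ltn_eqF // leqW.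
  by move/config_leP: yl => /(_ i); rewrite yi -kE ui => /(_ isT).
- have fx0 : climb x i = false.
    by rewrite (climbE _ kN xk) (negPf (xj _ (ltnW kN))) (negPf (xj _ kN)).
  have xi : x i by move: fxi; rewrite fx0; case: (x i).
  have yx : config_le y x.
    apply/config_leP=> j; case: (eqVneq j i) => [->//|ji].
    by rewrite y_eq.
  apply: (@ClimbLow _ _ k) => // [|j jN]; first exact: config_le_trans xk.
  by apply: contra (xj j jN) => /config_le_trans; apply.
- have fx1 : climb x i.
    rewrite ffunE; apply/orP; right; apply/existsP=> -[k].
    exact/negP/xh.
  have xi : ~~ x i by rewrite -fxi.
  have xy : config_le x y.
    apply/config_leP=> j; case: (eqVneq j i) => [->|ji]; first by rewrite (negPf xi).
    by rewrite y_eq.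
  apply: ClimbHigh => k kN; apply: contra (xh k kN).
  exact: config_le_trans.
Qed.

Lemma climb_inv_path t x p :
  path (async climb) x p -> climb_inv t x -> climb_inv (t + size p) (last x p).
Proof.
elim: p t x => [|y p IHp] t x /=; first by rewrite addn0.
by case/andP=> xy py /(climb_inv_step xy) /(IHp _ _ py); rewrite addSnnS.
Qed.

Lemma le_climb_path p :
  path (async climb) (c 0) p -> last (c 0) p = c N -> N.*2 <= size p.
Proof.
move=> c_p p_c; have pN : N.-1 < N by rewrite prednK.
have cNl : config_le (c N) (link N.-1).
  by have := le_linkr N.-1; rewrite prednK.
have := climb_inv_path c_p (@ClimbCode 0 _ 0 (leq0n N) (leqnn 0) erefl).
(* Only the first case can hold at [c N], and there the antichain property gives [k = N]. *)
rewrite p_c add0n => -[k kN kp cE|k kN kp cE|k kN _ cj|ch].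
- by rewrite (@c_antichain N k) // cE config_lexx.
- have kE : k = N by apply: c_antichain (ltnW kN) _ _ => //; rewrite cE le_linkl.
  by rewrite kE ltnn in kN.
- by have := cj N (leqnn N); rewrite config_lexx.
- by have := ch _ pN; rewrite cNl.
Qed.

End Climb.

(** * The reflected Gray code *)

(* Bit [q] of the [k]-th word of the reflected Gray code on [m] bits, for
   [k < 2 ^ m]; the most significant bit has index [m.-1]. *)
Fixpoint gray (m k q : nat) : bool :=
  if m is m'.+1 then
    if q == m' then 2 ^ m' <= k
    else gray m' (if 2 ^ m' <= k then 2 ^ m'.+1 - k.+1 else k) q
  else false.

Lemma reflect_lt m k : 2 ^ m <= k -> k < 2 ^ m.+1 -> 2 ^ m.+1 - k.+1 < 2 ^ m.
Proof.
move=> mk km; rewrite expnS mul2n -addnn in km *.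
by rewrite ltn_subLR // addSn ltnS leq_add2r.
Qed.

(** Induction on [m]: a step inside either half is a step of the shorter code, run backwards in the
    upper half; between the halves only the top bit changes. *)
Lemma gray_step m k : k.+1 < 2 ^ m ->
  exists2 p, p < m & forall q, q < m -> gray m k.+1 q = gray m k q (+) (q == p).
Proof.
elim: m k => [//|m IHm] k km /=.
have [mk|mk|mk] := ltngtP (2 ^ m) k.+1.
- have mk' : 2 ^ m <= k by rewrite -ltnS.
  (* Reflection sends [k] and [k.+1] to [l.+1] and [l]. *)
  rewrite mk'; set l := 2 ^ m.+1 - k.+2.
  have kE : 2 ^ m.+1 - k.+1 = l.+1 by rewrite /l -subnSK.
  have [|p pm pE] := IHm l; first by rewrite -kE reflect_lt // ltnW.
  exists p => [|q]; first exact: ltnW.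
  rewrite ltnS leq_eqVlt; case: eqVneq => [->|qm] /= qm'; first by rewrite gtn_eqF.
  by rewrite kE pE // -addbA addbb addbF.
- rewrite leqNgt (ltnW mk) /=; have [p pm pE] := IHm k mk.
  exists p => [|q]; first exact: ltnW.
  rewrite ltnS leq_eqVlt; case: eqVneq => [->|qm] /= qm'; first by rewrite gtn_eqF.
  exact: pE.
(* Here [k.+1 = 2 ^ m], whose reflection is [k], so the lower bits coincide. *)
- exists m => // q _; have -> : (2 ^ m <= k) = false by rewrite mk ltnn.
  case: eqVneq => //= _; rewrite addbF; congr gray.
  by rewrite expnS mk mul2n -addnn addSnnS addnK.
Qed.

Lemma gray_inj m j k : j < 2 ^ m -> k < 2 ^ m ->
  (forall q, q < m -> gray m j q = gray m k q) -> j = k.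
Proof.
elim: m j k => [|m IHm] j k; first by rewrite expn0 !ltnS !leqn0 => /eqP-> /eqP->.
move=> jm km jk; have /= := jk m (ltnSn m); rewrite eqxx => jkm.
have {}jk q : q < m ->
    gray m (if 2 ^ m <= k then 2 ^ m.+1 - j.+1 else j) q =
    gray m (if 2 ^ m <= k then 2 ^ m.+1 - k.+1 else k) q.
  by move=> qm; have /= := jk q (ltnW qm); rewrite ltn_eqF // jkm.
move: jk; case: (leqP (2 ^ m) k) jkm => [mk mj|mk /negbT mj] /IHm jk.
  have jkE := jk (reflect_lt mj jm) (reflect_lt mk km).
  by apply/succn_inj; rewrite -(subKn jm) jkE subKn.
by apply: jk => //; rewrite ltnNge.
Qed.

(** * The dual-rail encoding of words *)

(* Coordinates [q.*2] and [q.*2.+1] hold bit [q] and its negation. *)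
Definition dual_rail (n : nat) (w : nat -> bool) : config n :=
  [ffun i : 'I_n => w i./2 (+) odd i].

Lemma dual_rail_flip m (v w : nat -> bool) p : p < m ->
  (forall q, q < m -> w q = v q (+) (q == p)) ->
  let x := dual_rail m.*2 v in let y := dual_rail m.*2 w in
  exists a r, [/\ x a = false, y a, x r, y r = false &
                  forall i, i != a -> i != r -> y i = x i].
Proof.
move=> pm vw x y.
have im (b : bool) : b + p.*2 < m.*2.
  apply: (@leq_trans p.+1.*2); last by rewrite leq_double.
  by rewrite doubleS; case: b.
have pE (b : bool) : (b + p.*2)./2 = p by rewrite half_bit_double.
have oE (b : bool) : odd (b + p.*2) = b by rewrite oddD odd_double addbF; case: b.
(* Coordinate [b + p.*2] of [x] is [v p (+) b]: the 1 of pair [p] sits at [b = ~~ v p] and moves to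
   [b = v p]. *)
exists (Ordinal (im (v p))), (Ordinal (im (~~ v p))).
split; rewrite ?ffunE /= ?pE ?oE ?vw ?eqxx //; try by case: (v p).
move=> i ia ir; rewrite !ffunE vw; last first.
  by rewrite -ltn_double -(ltn_add2l (odd i)) odd_double_half
             (leq_trans (ltn_ord i)) // leq_addl.
case: eqVneq => [ip|_]; last by rewrite addbF.
have := odd_double_half i; rewrite ip => iE.
case: (eqVneq (odd i) (v p)) => [ov|ov].
  by case/eqP: ia; apply: val_inj; rewrite /= -ov iE.
by case/eqP: ir; apply: val_inj; rewrite /= -iE; case: (odd i) (v p) ov => [] [].
Qed.

(** Where [v] and [w] agree, their join has a single 1 in pair [q], which must be that of [u]. *)
Lemma le_dual_rail m (u v w : nat -> bool) q : q < m -> w q = v q ->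
  (forall i, dual_rail m.*2 u i ->
             dual_rail m.*2 v i || dual_rail m.*2 w i) -> u q = v q.
Proof.
move=> qm wv uvw.
have im (b : bool) : b + q.*2 < m.*2.
  apply: (@leq_trans q.+1.*2); last by rewrite leq_double.
  by rewrite doubleS; case: b.
have := uvw (Ordinal (im (~~ u q))); rewrite !ffunE /= half_bit_double wv orbb.
rewrite oddD odd_double addbF.
by case: (u q) (v q) => [] [] //= /(_ isT).
Qed.

(** * The climb along the encoded Gray code *)

Theorem theorem4 (n : nat) (n_gt0 : 0 < n) (n_even : ~~ odd n) :
  exists (f : config n -> config n) (x y : config n),
    [/\ monotone_network f,
        f y = y,
        enat_le (dist (async f) x y) (Some (diam (async f))) &
        enat_le (Some (2 ^ (n %/ 2))) (dist (async f) x y)].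
Proof.
have nE : n = (n./2).*2 by rewrite even_halfK.
rewrite divn2; move: n./2 nE => m nE.
move: n_gt0; rewrite {n n_even}nE double_gt0 => m_gt0.
pose N := (2 ^ m).-1; have NE : N.+1 = 2 ^ m by rewrite prednK ?expn_gt0.
have N_gt0 : 0 < N by rewrite -ltnS NE -{1}(expn0 2) ltn_exp2l.
(* The [minn] freezes the sequence from index [N] on, as [c_end] demands. *)
pose c k := dual_rail m.*2 (gray m (minn k N)).
have cE k : k <= N -> c k = dual_rail m.*2 (gray m k) by move=> kN; rewrite /c (minn_idPl kN).
have c_end : c N.+1 = c N by rewrite /c minnn (minn_idPr (leqnSn N)).
have flip k : k < N -> exists2 p, p < m &
    forall q, q < m -> gray m k.+1 q = gray m k q (+) (q == p).
  by move=> kN; apply: gray_step; rewrite -NE.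
have c_step k : k < N -> exists a r,
    [/\ c k a = false, c k.+1 a, c k r, c k.+1 r = false &
        forall i, i != a -> i != r -> c k.+1 i = c k i].
  move=> kN; have [p pm pE] := flip k kN.
  by rewrite (cE k (ltnW kN)) (cE k.+1 kN); apply: dual_rail_flip pm pE.
have c_link j k : j <= N -> k < N -> config_le (c j) (link c k) ->
    j = k \/ j = k.+1.
  move=> jN kN /config_leP jk; have [p pm pE] := flip k kN.
  (* Word [j] agrees with word [k] off the flipped bit [p], so bit [p] alone decides between [k] and
     [k.+1]. *)
  have off q : q < m -> q != p -> gray m j q = gray m k q.
    move=> qm qp; apply: (@le_dual_rail m _ _ (gray m k.+1)) => //.
      by rewrite pE // (negPf qp) addbF.
    by move=> i; have := jk i; rewrite [link _ _ _]ffunE !cE // ltnW.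
  case: (eqVneq (gray m j p) (gray m k p)) => jkp; [left|right].
    apply: (@gray_inj m); rewrite -?NE ?ltnS // 1?ltnW // => q qm.
    by case: (eqVneq q p) => [->//|]; apply: off.
  apply: (@gray_inj m); rewrite -?NE ?ltnS // => q qm; rewrite pE //.
  case: eqVneq => [->|qp]; last by rewrite addbF off.
  by case: (gray m j p) (gray m k p) jkp => [] [].
exists (climb N c), (c 0), (c N); split.
- exact: climb_monotone.
- by rewrite climb_c.
- exact/dist_le_diam/connect_climb.
- apply: le_dist => p c_p p_c; apply: leq_trans (le_climb_path _ _ _ _ c_p p_c) => //.
  (* [2 ^ m = N + 1 <= N + N] since [0 < N]. *)
  by rewrite -NE -addnn -[N.+1]addn1 leq_add2l.
Qed.
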